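(* For every constant $c>0$ there exists $n_0$ such that for all $n\ge n_0$ the following holds. Let $G$ be a graph of order $n$ with minimum degree $\delta(G)\ge (3/4+c)n$. Then $\mathcal{D}(G,\mathcal{H})\ge cn/32$; that is, for every labeling $f:E(G)\to\{-1,1\}$ there is a Hamilton cycle $H$ of $G$ with $\left|\sum_{e\in E(H)} f(e)\right|\ge cn/32$.
   Context: All graphs are finite and simple. For a graph $G$, a family $\mathcal{S}_G$ of subgraphs of $G$ and a labeling $f:E(G)\to\{-1,1\}$, put $f(S)=\sum_{e\in E(S)}f(e)$ for $S\in\mathcal{S}_G$. The discrepancy is $\mathcal{D}(G,\mathcal{S}_G)=\min_{f}\max_{S\in\mathcal{S}_G}|f(S)|$, the minimum being over all $f:E(G)\to\{-1,1\}$. Here $\mathcal{H}$ is the set of Hamilton cycles of $G$. *)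

(* Defs.v *)
From mathcomp Require Import all_boot all_order all_algebra.
Set Implicit Arguments.
Unset Strict Implicit.
Unset Printing Implicit Defensive.

Record sgraph := SGraph {
  vertex :> finType;
  adj : rel vertex;
  adj_sym : symmetric adj;
  adj_irr : irreflexive adj }.

Section Graph.
Variable G : sgraph.

Definition degree (x : G) : nat := #|[set y | adj x y]|.

(* Degrees never exceed #|G|, so the unit #|G| of the iterated minimum is
   harmless as soon as G has a vertex. *)
Definition min_degree : nat := \big[minn/#|G|]_(x : G) degree x.

Definition edges : {set {set G}} :=
  [set e : {set G} | [exists x, exists y, adj x y && (e == [set x; y])]].

Definition edge : finType := {e : {set G} | e \in edges}.

Definition sign : finType := seq_sub [:: (-1)%R; 1%R : int].

Definition labeling : finType := {ffun edge -> sign}.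

(* A subgraph is given by its edge set, as f(S) depends on nothing else. *)
Definition weight (f : labeling) (S : {set {set G}}) : int :=
  (\sum_(e : edge | val e \in S) val (f e))%R.

Definition max_weight (F : {set {set {set G}}}) (f : labeling) : nat :=
  \max_(S in F) `|weight f S|%N.

Definition sign1 : sign := @SeqSub _ [:: (-1)%R; 1%R : int] 1%R isT.

(* The constant labeling is only the witness of nonemptiness required by
   arg min, which ranges over all labelings. *)
Definition discrepancy (F : {set {set {set G}}}) : nat :=
  max_weight F [arg min_(f < [ffun=> sign1] : labeling) max_weight F f]%N.

Definition cycle_edges (s : seq G) : {set {set G}} :=
  [set [set x; next s x] | x in s].

(* A duplicate-free #|G|.-tuple lists every vertex exactly once. *)
Definition hamilton_cycles : {set {set {set G}}} :=
  [set cycle_edges s | s : #|G|.-tuple G &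
     [&& 2 < #|G|, uniq s & cycle (@adj G) s]].

End Graph.

(* Main.v *)
(** Call four vertices [a b c d] a gadget if both paths [a b c d] and [a c b d]
    exist and have different weights. Either many disjoint gadgets can be
    chained into a short path, or deleting few vertices destroys all gadgets.
    In a graph of minimum degree above [3n/4], a short path always extends to a
    Hamilton cycle: while the cycle has few vertices, two consecutive ones have
    a common neighbour outside it; afterwards an outside vertex is adjacent to
    more than half of the cycle, hence to two consecutive vertices. In the first
    case, swapping the interiors of all [k] gadgets changes the weight by at
    least [2k], so one of the two cycles has weight at least [k] in absolute
    value. In the second case the colouring is [F x y = (p x + p y) / 2] off the
    deleted vertices, which forces one colour [s] on all edges avoiding an
    independent set; this set has at most [n/4] vertices, so every Hamilton
    cycle has most of its edges coloured [s]. *)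
Require Import Defs.
From mathcomp Require Import all_boot all_order all_algebra.
From mathcomp Require Import reals zify lra.
Import Order.TTheory GRing.Theory Num.Theory.

(** * Counting in finite types and degrees *)

Lemma leq_cardsI (T : finType) (A B : {set T}) :
  #|A| + #|B| <= #|T| + #|A :&: B|.
Proof. by rewrite -cardsUI leq_add2r max_card. Qed.

Lemma min_degree_le (G : sgraph) (x : G) : min_degree G <= degree x.
Proof.
rewrite /min_degree; have := mem_index_enum x.
elim: (index_enum _) => //= y r IHr; rewrite inE big_cons => /predU1P[<-|/IHr].
  exact: geq_minl.
exact/leq_trans/geq_minr.
Qed.

Lemma notin_seq_exists (T : finType) (s : seq T) :
  size s < #|T| -> exists v, v \notin s.
Proof.
move=> lt_s; apply/existsP; rewrite -negb_forall; apply: contraL lt_s.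
move=> /forallP s_all; rewrite -leqNgt (leq_trans _ (card_size s)) //.
by apply/subset_leq_card/subsetP => x _; apply: s_all.
Qed.

(** * Common neighbours, and extending a path to a Hamilton cycle *)

Section DenseGraph.
Variables (G : sgraph) (D : nat).
Hypothesis degD : forall x : G, D <= degree x.

Lemma common_neighbour (W : {set G}) (x y : G) : #|W| + #|G| < 2 * D ->
  exists z, [/\ z \notin W, adj x z & adj y z].
Proof.
move=> ltW; have dx := degD x; have dy := degD y.
have I1 := leq_cardsI _ [set z | adj x z] [set z | adj y z].
have I2 := leq_cardsI _ (~: W) ([set z | adj x z] :&: [set z | adj y z]).
have := cardsC W; rewrite /degree in dx dy *; move=> WC.
have /card_gt0P[z] : 0 < #|~: W :&: ([set z | adj x z] :&: [set z | adj y z])|.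
  by lia.
by rewrite !inE => /and3P[*]; exists z.
Qed.

(** The non-neighbours of [x] join the forbidden set, which reduces three vertices to two. *)
Lemma common_neighbour3 (W : {set G}) (x y z : G) : #|W| + 2 * #|G| < 3 * D ->
  exists t, [/\ t \notin W, adj x t, adj y t & adj z t].
Proof.
move=> ltW; have dx := degD x; pose W' := W :|: ~: [set t | adj x t].
have W'C := cardsC [set t | adj x t].
have [W'le _] := leq_card_setU W (~: [set t | adj x t]).
rewrite -/W' in W'le; have DG : D <= #|G| := leq_trans dx (max_card _).
have /(common_neighbour W' y z)[] : #|W'| + #|G| < 2 * D.
  by rewrite /degree in dx; lia.
by move=> t [] /[!inE]; rewrite negb_or negbK => /andP[*]; exists t.
Qed.

Lemma common_neighbour_seq (s : seq G) (x y : G) : size s + #|G| < 2 * D ->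
  exists z, [/\ z \notin s, adj x z & adj y z].
Proof.
move=> lts; have [|z []] := common_neighbour [set z in s] x y.
  by apply: leq_ltn_trans lts; rewrite leq_add2r cardsE card_size.
by rewrite inE => *; exists z.
Qed.

(* If no insertion is possible, neighbours of [v] never occur consecutively. *)
Lemma path_insert (v d : G) (s : seq G) : path (@adj G) d s ->
  size s + 2 < 2 * count (adj v) (d :: s) ->
  exists s1 s2, [/\ s = s1 ++ s2, s2 != [::] & path (@adj G) d (s1 ++ v :: s2)].
Proof.
move=> p_s; suff: (exists s1 s2, [/\ s = s1 ++ s2, s2 != [::]
    & path (@adj G) d (s1 ++ v :: s2)]) \/
  2 * count (adj v) (d :: s) <= size (d :: s) + adj v d.
  by case=> // /=; lia.
elim: s d p_s => [|y s IHs] d /=; first by right; lia.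
case/andP=> dy ps; have [[s1 [s2 [-> nz ps']]]|le_s] := IHs _ ps.
  by left; exists (y :: s1), s2; split; rewrite //= dy.
case vd: (adj v d); case vy: (adj v y) => //; rewrite /= ?vd ?vy in le_s *;
  [left|right; lia..].
by exists [::], (y :: s); split; rewrite //= adj_sym vd vy.
Qed.

(** Vertices are inserted one at a time into the closing path [p], so [q] stays intact. Once the
    cycle has at least [2 * D - #|G|] vertices, an outside vertex has at least [D + size p - #|G|]
    neighbours in [p]; the bound on [D] makes this exceed [(size p + 3) / 2], as [path_insert]
    requires. *)
Lemma hamilton_extend (x : G) (q : seq G) :
  uniq (x :: q) -> 3 * #|G| + size (x :: q) + 4 <= 4 * D ->
  exists p, [/\ path (@adj G) (last x q) (rcons p x), uniq (x :: q ++ p)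
    & size (x :: q ++ p) = #|G|].
Proof.
move=> uq leD; have DG : D <= #|G| := leq_trans (degD x) (max_card _).
suff ext m : size (x :: q) + m.+1 <= #|G| ->
  exists p, [/\ path (@adj G) (last x q) (rcons p x), uniq ((x :: q) ++ p)
    & size p = m.+1].
  have [|p [pp up sp]] := ext (#|G| - size (x :: q)).-1; first by lia.
  by exists p; split=> //; rewrite -cat_cons size_cat sp; lia.
elim: m => [|m IHm] lem.
  have [|z [zq xz yz]] := common_neighbour_seq (x :: q) (last x q) x.
    by lia.
  exists [:: z]; split=> //; first by rewrite /= xz adj_sym yz.
  by rewrite cats1 rcons_uniq zq.
have [|p [pp up sp]] := IHm; first by lia.
have scat : size ((x :: q) ++ p) = size (x :: q) + m.+1 by rewrite size_cat sp.
suff [v [s1 [s2 [vp ps pv]]]] : exists v s1 s2, [/\ v \notin (x :: q) ++ p,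
    p = s1 ++ s2 & path (@adj G) (last x q) (rcons (s1 ++ v :: s2) x)].
  exists (s1 ++ v :: s2); split=> //; last first.
    by rewrite size_cat /= addnS -size_cat -ps sp.
  have /perm_uniq-> : perm_eq ((x :: q) ++ s1 ++ v :: s2) (v :: (x :: q) ++ p).
    by rewrite ps !catA; apply: (permEl (perm_catCA _ [:: v] s2)).
  by rewrite /= vp.
have [small|big] := ltnP (size ((x :: q) ++ p) + #|G|) (2 * D).
  case: p pp up sp scat small => // y p pp up sp scat small.
  have [v [vp v1 v2]] := common_neighbour_seq _ (last x q) y small.
  exists v, [::], (y :: p); split=> //=; move: pp => /= /andP[_ ->].
  by rewrite v1 adj_sym v2.
have [|v vp] := notin_seq_exists G ((x :: q) ++ p); first by lia.
have [] := path_insert v _ _ pp.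
  have cp : count (adj v) p <= count (adj v) (last x q :: rcons p x).
    by rewrite /= -cats1 count_cat; lia.
  have : #|[set z | adj v z] :&: [set z in p]| <= count (adj v) p.
    rewrite -size_filter; apply: leq_trans (card_size _).
    by apply/subset_leq_card/subsetP => z; rewrite !inE mem_filter.
  have := leq_cardsI _ [set z | adj v z] [set z in p].
  have -> : #|[set z in p]| = size p.
    by rewrite cardsE; apply/card_uniqP; move: up; rewrite cat_uniq => /and3P[].
  have := degD v; rewrite /degree size_rcons.
  by move: cp leD scat big; rewrite sp /=; lia.
(* As [s2] is nonempty, [v] lands before the closing [x]. *)
move=> s1 [s2]; case/lastP: s2 => [[]//|s2 y] [].
rewrite -rcons_cat => /rcons_inj[ps <-] _ pv.
by exists v, s1, s2; split=> //; rewrite rcons_cat.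
Qed.

End DenseGraph.

Local Open Scope ring_scope.

(** * Chains of gadgets in an edge-coloured graph *)

Section Colouring.
Variables (G : sgraph) (D : nat) (F : G -> G -> int).
Hypothesis degD : forall x : G, (D <= degree x)%N.
Hypothesis FC : forall x y, F x y = F y x.
Hypothesis F1 : forall x y, adj x y -> F x y = 1 \/ F x y = -1.

Definition path_weight (x : G) (s : seq G) : int := \sum_(w <- pairmap F x s) w.

Lemma path_weight_cons x y s : path_weight x (y :: s) = F x y + path_weight y s.
Proof. by rewrite /path_weight /= big_cons. Qed.

Lemma path_weight_cat x s t :
  path_weight x (s ++ t) = path_weight x s + path_weight (last x s) t.
Proof. by rewrite /path_weight pairmap_cat big_cat. Qed.

(* [b] and [c] can be swapped in the path [a b c d], lowering its weight. *)
Definition gadget (W : {set G}) (a b c d : G) : bool :=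
  [&& [&& a \notin W, b \notin W, c \notin W & d \notin W],
      [&& adj a b, adj a c, adj b c, adj b d & adj c d] &
      F a c + F b d < F a b + F c d].

Definition gadget_free W := forall a b c d, ~~ gadget W a b c d.

(** Exchanging [b] and [c] turns a rise in weight into a drop, so excluding strict drops leaves only
    equality. *)
Lemma gadget_free_eq W a b c d : gadget_free W ->
  a \notin W -> b \notin W -> c \notin W -> d \notin W ->
  adj a b -> adj a c -> adj b c -> adj b d -> adj c d ->
  F a b + F c d = F a c + F b d.
Proof.
move=> free aW bW cW dW ab ac bc bd cd.
have := free a b c d; have := free a c b d.
rewrite /gadget aW bW cW dW ab ac bc bd cd adj_sym bc /=.
by rewrite -!leNgt => ? ?; apply/le_anti/andP.
Qed.

(** Induction on [k]: a gadget off the current path is appended through a linking vertex [z]; if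
    there is none, [W] is the vertex set of the path. Each gadget costs five vertices and widens the
    gap by at least 2, since sums of two signs differ by an even number. *)
Lemma gadget_paths k : (0 < #|G|)%N -> (5 * k + #|G| < 2 * D)%N ->
  (exists2 W : {set G}, (#|W| <= 5 * k + 1)%N & gadget_free W) \/
  exists x q1 q2, [/\ path (@adj G) x q1 /\ path (@adj G) x q2,
    last x q1 = last x q2, perm_eq q1 q2, uniq (x :: q1) /\ size q1 = (5 * k)%N
    & path_weight x q2 + 2 * k%:Z <= path_weight x q1].
Proof.
case/card_gt0P=> x0 _; elim: k => [|k IHk] ltD.
  by right; exists x0, [::], [::]; split=> //; rewrite /path_weight /= big_nil.
case: IHk; first by lia.
  by case=> W leW free; left; exists W; rewrite // (leq_trans leW) //; lia.
case=> x [q1 [q2 [[p1 p2] eq_l eq_q [u1 sz] w]]].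
pose W := [set y in x :: q1].
have leW : (#|W| <= 5 * k + 1)%N.
  by rewrite cardsE (leq_trans (card_size _)) //= sz addn1.
have [|free] := boolP [exists a, exists b, exists c, exists d, gadget W a b c d];
  last first.
  left; exists W; first by rewrite (leq_trans leW) //; lia.
  move=> a b c d; apply: contra free => g.
  apply/existsP; exists a; apply/existsP; exists b.
  by apply/existsP; exists c; apply/existsP; exists d.
case/existsP=> a /existsP[b /existsP[c /existsP[d]]].
case/and3P=> /and4P[aW bW cW dW] /and5P[ab ac bc bd cd] ltF; right.
have [|z [zq xz az]] :=
    @common_neighbour_seq G D degD (x :: q1 ++ [:: a; b; c; d]) (last x q1) a.
  by move: ltD; rewrite /= size_cat /= sz; clear; lia.
exists x, (q1 ++ [:: z; a; b; c; d]), (q2 ++ [:: z; a; c; b; d]); split.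
- rewrite !cat_path p1 p2 -eq_l /= xz [adj z a]adj_sym az ab ac bc bd cd.
  by rewrite [adj c b]adj_sym bc.
- by rewrite !last_cat.
- apply: perm_cat => //; rewrite 2!perm_cons.
  exact: (permEl (perm_catCA [:: b] [:: c] [:: d])).
- split; last by rewrite size_cat sz mulnS addnC.
  have nadj y t : adj y t -> y != t.
    by apply: contraTneq => ->; rewrite adj_irr.
  (* With [a = d] the two sides of [ltF] would coincide. *)
  have ad : a != d.
    by apply: contraTneq ltF => <-; rewrite (FC c a) (FC b a) addrC ltxx.
  rewrite -cat_cons cat_uniq u1 /= !inE !negb_or.
  move: aW bW cW dW zq; rewrite !inE mem_cat !inE !negb_or.
  move=> /andP[-> ->] /andP[-> ->] /andP[-> ->] /andP[-> ->].
  case/and3P=> -> -> /and4P[-> -> -> ->] /=.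
  by rewrite ad !nadj.
- rewrite !path_weight_cat -eq_l !path_weight_cons (FC c b).
  move: w ltF (F1 _ _ ab) (F1 _ _ ac) (F1 _ _ bd) (F1 _ _ cd).
  by clear; lia.
Qed.

(** * Colourings without gadgets *)

Section GadgetFree.
Variable W : {set G}.
Hypotheses (free : gadget_free W) (ltW : (#|W| + 2 * #|G| < 3 * D)%N).

Let triangle b c d := [&& c \notin W, d \notin W, adj b c, adj b d & adj c d].

Let triangle_exists b c : c \notin W -> adj b c -> {d | triangle b c d}.
Proof.
move=> cW bc; apply/sigW.
have [d [dW bd _ cd]] := common_neighbour3 _ _ degD W b b c ltW.
by exists d; rewrite /triangle cW dW bc bd cd.
Qed.

(** If [F x y = (p x + p y) / 2], this recovers [p b] from a triangle. *)
Let pot b c d := F b c + F b d - F c d.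

(* Triangles [b c d] and [b c' d'] are linked through a common neighbour of
   [b], [c] and [c']. *)
Let pot_uniq b c d c' d' : b \notin W -> triangle b c d -> triangle b c' d' ->
  pot b c d = pot b c' d'.
Proof.
move=> bW /and5P[cW dW bc bd cd] /and5P[cW' dW' bc' bd' cd'].
have [e [eW be ce ce']] := common_neighbour3 _ _ degD W b c c' ltW.
(* Consecutive triangles among [b c d], [b c e], [b e c'], [b c' d'] share an edge at [b]; each
   equation equates their values of [pot]. *)
have E1 := gadget_free_eq _ d b c e free dW bW cW eW.
have E2 := gadget_free_eq _ c b e c' free cW bW eW cW'.
have E3 := gadget_free_eq _ e b c' d' free eW bW cW' dW'.
move: E1 E2 E3; rewrite ![adj d _]adj_sym ![adj c b]adj_sym ![adj e _]adj_sym.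
move=> /(_ bd cd bc be ce) E1 /(_ bc ce be bc' ce') E2 /(_ be ce' bc' bd' cd') E3.
move: E1 E2 E3; rewrite /pot ![F d _]FC ![F e _]FC ![F c b]FC; clear; lia.
Qed.

(* [F] splits as half the sum of potentials [p x] in {1, -1, 3, -3}; as any two
   vertices have a common neighbour, all potentials are congruent modulo 4. *)
Lemma gadget_free_structure : exists (s : int) (A : {set G}),
  [/\ s = 1 \/ s = -1, {in A &, forall x y, ~~ adj x y} &
    forall x y, adj x y -> x \notin A :|: W -> y \notin A :|: W -> F x y = s].
Proof.
have /fin_all_exists[p pP] b : exists p : int, b \notin W ->
    forall c d, triangle b c d -> pot b c d = p.
  have [c [cW bc _ _]] := common_neighbour3 _ _ degD W b b b ltW.
  have [d t] := triangle_exists b c cW bc.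
  by exists (pot b c d) => bW c' d' t'; apply: pot_uniq.
have pF b c : b \notin W -> c \notin W -> adj b c -> p b + p c = 2 * F b c.
  move=> bW cW bc; have [d t] := triangle_exists b c cW bc.
  have /and5P[_ dW _ bd cd] := t; have t' : triangle c b d.
    by rewrite /triangle bW dW adj_sym bc cd bd.
  by rewrite -(pP b bW c d t) -(pP c cW b d t') /pot (FC c b); clear; lia.
have p3 b : b \notin W -> [\/ p b = 1, p b = -1, p b = 3 | p b = -3].
  move=> bW; have [c [cW bc _ _]] := common_neighbour3 _ _ degD W b b b ltW.
  have [d t] := triangle_exists b c cW bc.
  have /and5P[_ _ _ bd cd] := t; rewrite -(pP b bW c d t) /pot.
  have [->|->] := F1 _ _ bc; have [->|->] := F1 _ _ bd; have [->|->] := F1 _ _ cd;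
  by [constructor 1 | constructor 2 | constructor 3 | constructor 4].
have [/setP WT|] := eqVneq W [set: G].
  exists 1, set0; split=> [|x y|x y _]; first by left.
    by rewrite inE.
  by rewrite inE WT !inE.
rewrite -subTset => /subsetPn[v _ vW].
(* The sign [s] is congruent to [p v] modulo 4, so every potential is [s] or [- 3 * s]. *)
pose s : int := if (p v == 1) || (p v == -3) then 1 else -1.
have ps b : b \notin W -> p b = s \/ p b = - 3 * s.
  move=> bW; have [c [cW vc bc _]] := common_neighbour3 _ _ degD W v b b ltW.
  have := pF _ _ vW cW vc; have := pF _ _ bW cW bc; rewrite /s.
  case: (F1 _ _ vc) => ->; case: (F1 _ _ bc) => ->;
  case: (p3 v vW) => ->; case: (p3 b bW) => ->; case: (p3 c cW) => -> //=;
  by clear; lia.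
have s1 : s = 1 \/ s = -1 by rewrite /s; case: ifP; [left|right].
(* Here [p b = - 3 * s]; an edge inside this set would have potential sum [- 6 * s], which is not 2
   or -2. *)
exists s, [set b | (b \notin W) && (p b != s)]; split=> //.
  move=> x y; rewrite !inE => /andP[xW xs] /andP[yW ys]; apply/negP => xy.
  have := pF _ _ xW yW xy; case: (ps x xW) (ps y yW) => /eqP Ex [] /eqP Ey.
  - by rewrite Ex in xs.
  - by rewrite Ex in xs.
  - by rewrite Ey in ys.
  - by move: (F1 _ _ xy) s1 Ex Ey; clear; lia.
move=> x y xy; rewrite !inE !negb_or => /andP[] + xW => /[!xW] /negPn/eqP Ex.
case/andP => + yW => /[!yW] /negPn/eqP Ey.
by have := pF _ _ xW yW xy; rewrite Ex Ey; clear; lia.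
Qed.

End GadgetFree.
End Colouring.

(** * Weights of Hamilton cycles under a labeling *)

Lemma pairmap_next (T : eqType) (S : Type) (F : T -> T -> S) (x : T) (q : seq T) :
  uniq (x :: q) ->
  [seq F y (next (x :: q) y) | y <- x :: q] = pairmap F x (rcons q x).
Proof.
move=> uq; apply: (@eq_from_nth _ (F x x)).
  by rewrite size_map size_pairmap size_rcons.
move=> i; rewrite size_map => lti; rewrite (nth_map x) // next_nth mem_nth //.
rewrite index_uniq // (nth_pairmap x) ?size_rcons //.
rewrite -rcons_cons !nth_rcons lti; congr (F _ _).
(* At the last index [nth] runs off [q] and returns its default [x], the closing vertex. *)
by move: lti => /=; rewrite ltnS; case: ltngtP => // -> _; rewrite nth_default.
Qed.

Section Labeling.
Variables (G : sgraph) (f : labeling G).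

(** Extending [f] by 0 off the edges lets [colour] be total on pairs of vertices. *)
Definition set_label (X : {set G}) : int :=
  oapp (fun e : edge G => val (f e)) 0 (insub X).

Definition colour (x y : G) : int := set_label [set x; y].

Lemma colourC x y : colour x y = colour y x.
Proof. by rewrite /colour setUC. Qed.

Lemma mem_edges (x y : G) : adj x y -> [set x; y] \in edges G.
Proof.
move=> xy; rewrite inE; apply/existsP; exists x; apply/existsP; exists y.
by rewrite xy eqxx.
Qed.

Lemma colour_adj x y : adj x y -> colour x y = 1 \/ colour x y = -1.
Proof.
move=> /mem_edges xy; rewrite /colour /set_label.
case: insubP => [e _ _|]; last by rewrite xy.
by have := valP (f e); rewrite !inE => /orP[]/eqP /= ->; [right|left].
Qed.

(** Beyond length 2 no edge is counted twice: a repeated edge would force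
    [next s (next s x) = x]. *)
Lemma weight_cycle s : uniq s -> cycle (@adj G) s -> (2 < size s)%N ->
  weight f (cycle_edges s) = \sum_(x <- s) colour x (next s x).
Proof.
move=> us cs lt2s.
have next_next x : x \in s -> next s (next s x) != x.
  case/rot_to=> i [|y [|z t]] def_s.
  - by rewrite -(size_rot i) def_s in lt2s.
  - by rewrite -(size_rot i) def_s in lt2s.
  rewrite -!(next_rot i us) def_s.
  have : uniq [:: x, y, z & t] by rewrite -def_s rot_uniq.
  rewrite /= !inE !negb_or eqxx => /and3P[/and3P[xy xz _] /andP[yz _] _].
  by rewrite [y == x]eq_sym (negPf xy) eqxx eq_sym.
have inj_edge : {in s &, injective (fun x => [set x; next s x])}.
  move=> x y xs ys /= eq_xy; apply/eqP; apply: contraT => neq_xy.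
  have : x \in [set y; next s y] by rewrite -eq_xy !inE eqxx.
  have : y \in [set x; next s x] by rewrite eq_xy !inE eqxx.
  rewrite !inE (negPf neq_xy) eq_sym (negPf neq_xy) /= => /eqP yE /eqP xE.
  by have := next_next x xs; rewrite -yE -xE eqxx.
have sub_edges X : X \in cycle_edges s -> X \in edges G.
  by case/imsetP=> x xs ->; apply/mem_edges/next_cycle.
transitivity (\sum_(X in cycle_edges s) set_label X).
  have -> : cycle_edges s = val @: [set e : edge G | val e \in cycle_edges s].
    apply/setP=> X; apply/idP/imsetP=> [Xs|[e + ->]]; last by rewrite inE.
    by exists (exist _ X (sub_edges X Xs)); rewrite ?inE.
  rewrite big_imset /=; last by move=> ? ? _ _; apply: val_inj.
  apply: eq_big => [e|e _]; last by rewrite /set_label valK.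
  by rewrite inE mem_imset ?inE //; apply: val_inj.
by rewrite big_imset //= big_uniq.
Qed.

(** Cutting at the end of [q] isolates the summand that a swap of gadget interiors changes. *)
Lemma hamilton_cycle_path x q p :
  (2 < #|G|)%N -> path (@adj G) x q -> path (@adj G) (last x q) (rcons p x) ->
  uniq (x :: q ++ p) -> size (x :: q ++ p) = #|G| ->
  cycle_edges (x :: q ++ p) \in hamilton_cycles G /\
  weight f (cycle_edges (x :: q ++ p)) =
    path_weight G colour x q + path_weight G colour (last x q) (rcons p x).
Proof.
move=> lt2 pq pp us sz.
have cs : cycle (@adj G) (x :: q ++ p) by rewrite /= rcons_cat cat_path pq.
split.
  have sz' : size (x :: q ++ p) == #|G| by apply/eqP.
  by apply/imsetP; exists (Tuple sz'); rewrite // inE lt2 us cs.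
rewrite weight_cycle ?sz // -path_weight_cat -rcons_cat /path_weight.
by rewrite -pairmap_next // big_map.
Qed.

(* An edge of a cycle whose colour is not [s] has an endpoint in [B], and every
   vertex is an endpoint of two edges of the cycle. *)
Lemma weight_hamilton_near_mono (s : int) (B : {set G}) (c : seq G) :
  s = 1 \/ s = -1 ->
  (forall x y, adj x y -> x \notin B -> y \notin B -> colour x y = s) ->
  uniq c -> cycle (@adj G) c -> size c = #|G| -> (2 < #|G|)%N ->
  (#|G| <= `|weight f (cycle_edges c)| + 4 * #|B|)%N.
Proof.
move=> s1 mono uc cc szc lt2; rewrite weight_cycle ?szc //.
have c_all x : x \in c.
  have /subset_leqif_card := subset_predT (mem c); have /card_uniqP-> := uc.
  by rewrite szc => -[_]; rewrite eqxx => /esym /subsetP ->.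
have -> : \sum_(x <- c) colour x (next c x) = \sum_(x : G) colour x (next c x).
  by rewrite big_uniq //; apply: eq_bigl => x; rewrite c_all.
set w := \sum_(x : G) _.
have sumB : \sum_(x : G) (x \in B : nat)%:Z = #|B|%:Z.
  rewrite -sum1_card [in RHS]big_mkcond (big_morph Posz PoszD (erefl 0%:Z)) /=.
  by apply: eq_bigr => x _; case: (x \in B).
have sumB' : \sum_(x : G) (next c x \in B : nat)%:Z = #|B|%:Z.
  by rewrite -sumB [RHS](reindex_inj (can_inj (prev_next uc))).
(* The left side totals [#|G| - 4 * #|B|], since [next c] permutes the vertices. *)
have : \sum_(x : G) (1 - 2 * (x \in B : nat)%:Z - 2 * (next c x \in B : nat)%:Z)
    <= \sum_(x : G) s * colour x (next c x).
  apply: ler_sum => x _; have adjx : adj x (next c x) by apply: next_cycle.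
  have [|] := boolP ((x \in B) || (next c x \in B)); last first.
    rewrite negb_or => /andP[xB yB]; rewrite (mono _ _ adjx xB yB).
    by rewrite (negPf xB) (negPf yB); case: s1 => ->.
  have [->|->] := colour_adj _ _ adjx; case: s1 => ->;
  by case: (x \in B); case: (next c x \in B).
have sum1 : \sum_(x : G) 1 = #|G|%:Z :> int by rewrite sumr_const natz.
rewrite !sumrB -!mulr_sumr sum1 sumB sumB' [X in s * X](_ : _ = w) //=.
by clear -s1; case: s1 => ->; lia.
Qed.

(* Without [k] gadgets, at most [5 * k + 1] vertices are deleted; by the previous
   lemma they cost [4 * (5 * k + 1)] in the weight, whence [21 * k]. *)
Lemma hamilton_discrepancy (D k : nat) : (forall x : G, D <= degree x)%N ->
  (0 < #|G|)%N -> (3 * #|G| + 21 * k + 5 <= 4 * D)%N ->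
  exists2 H, H \in hamilton_cycles G & (k <= `|weight f H|)%N.
Proof.
move=> degD G_gt0 leD; have /card_gt0P[x0 _] := G_gt0.
have DG : (D <= #|G|)%N := leq_trans (degD x0) (max_card _).
have lt2 : (2 < #|G|)%N by move: leD DG; clear; lia.
have [||[W leW free]|[x [q1 [q2 [[p1 p2] eq_l eq_q [uq sz] w]]]]] :=
  gadget_paths G D colour degD colourC colour_adj k => //.
- by move: leD DG; clear; lia.
- have [|s [A [s1 indep mono]]] :=
    gadget_free_structure G D colour degD colourC colour_adj W free.
    by move: leD DG leW; clear; lia.
  (* All neighbours of a vertex of the independent set [A] lie outside [A]. *)
  have leA : (#|A| <= #|G| - D)%N.
    have [->|[x xA]] := set_0Vmem A; first by rewrite cards0.
    have := degD x; have := cardsC A; rewrite /degree.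
    have /subset_leq_card : [set y | adj x y] \subset ~: A.
      apply/subsetP=> y; rewrite !inE; apply: contraTN => yA; exact: indep.
    by move: DG; clear; lia.
  have [||p [pp up sp]] := hamilton_extend G D degD x0 [::] => //.
    by move: leD; rewrite /=; clear; lia.
  have [H1 _] := hamilton_cycle_path x0 [::] p lt2 isT pp up sp.
  exists (cycle_edges (x0 :: p)) => //.
  have := weight_hamilton_near_mono s (A :|: W) (x0 :: p) s1 mono up pp sp lt2.
  have [le_AW _] := leq_card_setU A W.
  by move: le_AW leA leW leD DG; clear; lia.
have [||p [pp up sp]] := hamilton_extend G D degD x q1 => //.
  by move: leD; rewrite /= sz; clear; lia.
have [H1 w1] := hamilton_cycle_path x q1 p lt2 p1 pp up sp.
(* The same [p] closes both paths, as they share their ends and their vertex set. *)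
have perm12 : perm_eq (x :: q1 ++ p) (x :: q2 ++ p).
  by rewrite perm_cons perm_cat2r.
have [|||H2 w2] := hamilton_cycle_path x q2 p lt2 p2.
- by rewrite -eq_l.
- by rewrite -(perm_uniq perm12).
- by rewrite -(perm_size perm12).
have [le1|lt1] := leqP k `|weight f (cycle_edges (x :: q1 ++ p))|.
  by exists (cycle_edges (x :: q1 ++ p)).
exists (cycle_edges (x :: q2 ++ p)) => //.
by move: w lt1; rewrite w1 w2 -eq_l; clear; lia.
Qed.

End Labeling.

Theorem theorem1p1 (R : realType) (c : R) (hc : 0 < c) :
  exists n0 : nat, forall n : nat, (n0 <= n)%N ->
    forall G : sgraph, #|G| = n ->
      (3 / 4 + c) * n%:R <= (min_degree G)%:R :> R ->
      c * n%:R / 32 <= (discrepancy (hamilton_cycles G))%:R :> R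
      /\ (forall f : labeling G,
            exists2 H : {set {set G}}, H \in hamilton_cycles G
              & c * n%:R / 32 <= `|weight f H|%:~R :> R).
Proof.
(* Since [k <= c * n / 32 + 1], the bound [21 * k + 5 <= 4 * c * n] follows from
   [c * n >= 832 / 107], and 8 exceeds this. *)
exists (Num.truncn (8 / c)).+1 => n n_ge G cardG degG.
have n_gt : 8 < c * n%:R.
  rewrite mulrC -ltr_pdivrMr //; apply: lt_le_trans (truncnS_gt _) _.
  by rewrite ler_nat.
pose k := (Num.truncn (c * n%:R / 32)).+1.
have k_gt : c * n%:R / 32 < k%:R by apply: truncnS_gt.
have k_le : k%:R <= c * n%:R / 32 + 1.
  rewrite /k -natr1 lerD2r truncn_le; lra.
have leD : (3 * #|G| + 21 * k + 5 <= 4 * min_degree G)%N.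
  by rewrite cardG -(ler_nat R) !natrD !natrM; lra.
have G_gt0 : (0 < #|G|)%N by rewrite cardG; lia.
have main f : exists2 H, H \in hamilton_cycles G
    & c * n%:R / 32 <= `|weight f H|%N%:R :> R.
  have [H hamH leH] := hamilton_discrepancy G f _ k (min_degree_le G) G_gt0 leD.
  by exists H => //; apply: le_trans (ltW k_gt) _; rewrite ler_nat.
split=> [|f]; last first.
  by have [H hamH leH] := main f; exists H; rewrite // -abszE -pmulrn.
(* The discrepancy is [max_weight] at one particular labeling, to which [main] applies. *)
rewrite /discrepancy; set f := [arg min_(f < _) _]%N.
have [H hamH leH] := main f; apply: le_trans leH _; rewrite ler_nat.
exact: (@leq_bigmax_cond _ (mem (hamilton_cycles G)) (fun S => `|weight f S|%N)).
Qed.
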